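(* Let $\ell\in\mathbb{N}$ and let $\varphi:\mathbb{N}\to[3,\infty)$. Let \[ \mathcal{E}'_{\ell}(\varphi):=\{x\in[0,1): a_n'(x)\cdots a_{n+\ell-1}'(x)\geq \varphi(n)\text{ for infinitely many } n\in\mathbb{N}\}. \] Then the Lebesgue measure of $\mathcal{E}'_{\ell}(\varphi)$ is $0$ if $\displaystyle\sum_{n\geq 1}\frac{(\log\log\varphi(n))^{\ell-1}}{\varphi(n)\log\varphi(n)}<\infty$, and is $1$ if this series diverges.
   Context: For irrational $x\in(0,1)$ with continued fraction expansion $x=[a_1(x),a_2(x),\dots]=\cfrac{1}{a_1(x)+\cfrac{1}{a_2(x)+\cdots}}$, the $a_n(x)\in\mathbb{N}$ are its partial quotients. Define $a_n'(x)=a_n(x)$ if $a_n(x)$ is a prime number, and $a_n'(x)=0$ otherwise. *)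

(* Defs.v *)
From mathcomp Require Import all_boot all_order all_algebra.
From mathcomp Require Import all_classical all_reals all_analysis.
Set Implicit Arguments. Unset Strict Implicit. Unset Printing Implicit Defensive.
Import Order.TTheory GRing.Theory Num.Theory.
Local Open Scope ring_scope.

(* Gauss map T(x) = 1/x - floor(1/x) (with T(0) = 0 since 0^-1 = 0). *)
Definition gauss {R : realType} (x : R) : R := x^-1 - (Num.truncn x^-1)%:R.

(* n-th partial quotient a_n(x) = floor(1 / T^(n-1) x), for n >= 1.
   For x in (0,1) irrational this is the usual a_n(x); for rational x,
   once the expansion terminates it yields 0. *)
Definition pq {R : realType} (n : nat) (x : R) : nat :=
  Num.truncn (iter n.-1 (@gauss R) x)^-1.

Definition pq' {R : realType} (n : nat) (x : R) : nat :=
  if prime (pq n x) then pq n x else 0%N.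

Definition Eprime {R : realType} (l : nat) (phi : nat -> R) : set R :=
  [set x | (0 <= x < 1) /\
    forall N : nat, exists n : nat, (N <= n)%N /\ (0 < n)%N /\
      phi n <= (\prod_(n <= k < n + l) pq' k x)%:R].

(* Main.v *)
Require Import Defs.
From mathcomp Require Import all_boot all_order all_algebra.
From mathcomp Require Import all_classical all_reals all_analysis.
From mathcomp Require Import zify ring lra.
Set Implicit Arguments. Unset Strict Implicit. Unset Printing Implicit Defensive.
Import Order.TTheory GRing.Theory Num.Theory.

(** Given the first [m] partial quotients of [x], the next one equals [b] with
    conditional probability comparable to [b^-2], uniformly in the past (bounded
    distortion).  Hence, given the past, the conditional probability that the
    next [l] partial quotients are primes of product at least [t] is comparable
    to the sum of [(p_1 ... p_l)^-2] over [p_1 ... p_l >= t].  Sort primes by the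
    level [k] with [16^k <= p < 16^(k+1)].  By Chebyshev, level [k] contributes
    about [16^-k / (k+1)] to [sum p^-2], so the sum is governed by the [l]-fold
    convolution of [1/(k+1)], of size [(log n)^(l-1) / n] at [n]; with
    [n ~ log t] this is the general term of the series.

    Convergence is then Borel-Cantelli.  For divergence, the events attached to
    [n = N + r + j l] for a fixed residue [r < l] concern disjoint blocks, so the
    lower bound on conditional probabilities bounds the measure [w] of the points
    avoiding all of them by [prod (1 - v_n) <= 1 / (1 + sum v_n)], where [v_n] is
    a constant times the term of the series.  Summing [w (1 + sum v_n) <= 1] over
    the residues gives measure zero for the points avoiding all events from [N]
    on; no mixing or zero-one law is needed. *)

(** * Chebyshev bounds *)

(** Both [4 ^ n] bounds below are inductions on this recurrence, whose ratio is slightly below 4. *)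
Lemma central_binS n :
  n.+1 * 'C(n.+1.*2, n.+1) = (2 * n.*2.+1) * 'C(n.*2, n).
Proof.
have h1 := mul_bin_diag n.*2.+1 n.
have h2 := mul_bin_left n.*2 n.
rewrite doubleS.
have h3 : 'C(n.*2.+1, n) = 'C(n.*2.+1, n.+1).
  by rewrite -[RHS]bin_sub; [congr ('C(_, _)); lia | lia].
have h4 := binS n.*2 n.
have h5 := binS n.*2.+1 n.
have e : n.*2 - n = n by lia.
rewrite e in h2.
nia.
Qed.

Lemma central_bin_ge n : 0 < n -> 4 ^ n <= n.*2 * 'C(n.*2, n).
Proof.
case: n => // n _; elim: n => [|n IH] //.
rewrite expnS -[X in _ <= X * _]muln2 -mulnA [2 * _]mulnC mulnA central_binS.
nia.
Qed.

Lemma central_bin_le n : 'C(n.*2, n) <= 4 ^ n.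
Proof.
elim: n => [|n IH]; first by rewrite bin0.
have := central_binS n; rewrite expnS; nia.
Qed.

(** Legendre's formula for the three factorials; the sum for [n] is padded with zero terms up to
    [n.*2] so that the sums subtract term by term. *)
Lemma logn_central_bin p n : prime p ->
  logn p 'C(n.*2, n) = \sum_(1 <= k < n.*2.+1) (n.*2 %/ p ^ k - (n %/ p ^ k).*2).
Proof.
move=> pp.
have le k : (n %/ p ^ k).*2 <= n.*2 %/ p ^ k.
  by rewrite leq_divRL ?expn_gt0 ?prime_gt0 // -doubleMl leq_double leq_trunc_div.
have /(congr1 (logn p)) : 'C(n.*2, n) * (n`! * n`!) = n.*2`!.
  by rewrite -[RHS](@bin_fact _ n); [congr (_ * (_ * _`!)); lia | lia].
rewrite !lognM ?muln_gt0 ?fact_gt0 ?bin_gt0 //; last by lia.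
rewrite !logn_fact //.
have -> : \sum_(1 <= k < n.+1) n %/ p ^ k = \sum_(1 <= k < n.*2.+1) n %/ p ^ k.
  rewrite [RHS](@big_cat_nat _ _ _ n.+1) //=; last by lia.
  rewrite [X in _ = _ + X]big_nat_cond [X in _ = _ + X]big1 ?addn0 // => k.
  rewrite andbT => /andP[nk _]; apply: divn_small.
  by apply: leq_trans (ltn_expl _ (prime_gt1 pp)); lia.
move=> H; apply/eqP; rewrite -(eqn_add2r (\sum_(1 <= k < n.*2.+1) (n %/ p ^ k).*2)).
rewrite -big_split /=; under [X in _ == X]eq_bigr do rewrite subnK //.
rewrite -H; apply/eqP; congr addn.
by rewrite -big_split; apply: eq_bigr => k _; rewrite /= addnn.
Qed.

(** Each Legendre term is 0 or 1 and vanishes once [p ^ k > n.*2], so the exponent is at most the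
    base-[p] logarithm of [n.*2]. *)
Lemma pexp_logn_central_bin p n : 0 < n -> prime p -> p ^ logn p 'C(n.*2, n) <= n.*2.
Proof.
move=> n0 pp; rewrite logn_central_bin //.
set L := trunc_log p n.*2.
have p1 := prime_gt1 pp.
apply: leq_trans (trunc_logP p1 _); last by lia.
rewrite leq_exp2l // -/L.
have Ln : L.+1 <= n.*2.+1.
  rewrite ltnS; apply: leq_trans (ltnW (ltn_expl _ p1)) (trunc_logP p1 _); lia.
rewrite (@big_cat_nat _ _ _ L.+1) //= [X in _ + X]big_nat_cond [X in _ + X]big1 ?addn0; last first.
  move=> k; rewrite andbT => /andP[Lk _]; rewrite divn_small ?sub0n //.
  by apply: leq_trans (trunc_log_ltn _ p1) _; rewrite leq_exp2l.
apply: (@leq_trans (\sum_(1 <= k < L.+1) 1)); last by rewrite sum_nat_const_nat; lia.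
apply: leq_sum => k _.
have q0 : 0 < p ^ k by rewrite expn_gt0 prime_gt0.
have := divn_eq n (p ^ k); have := ltn_mod n (p ^ k); rewrite q0.
move: (n %/ _) (n %% _) => a b hb {1}->.
rewrite leq_subLR -ltnS ltn_divLR //; nia.
Qed.

Definition primepi n := \sum_(0 <= p < n | prime p) 1.

Lemma leq_prod_pow (I : Type) (r : seq I) (P : pred I) (F : I -> nat) c :
  (forall i, P i -> F i <= c) -> \prod_(i <- r | P i) F i <= c ^ (\sum_(i <- r | P i) 1).
Proof.
move=> h.
elim/big_rec2: _ => // i y x Pi IH.
by rewrite addnC expnD expn1 mulnC leq_mul // h.
Qed.

Lemma geq_prod_pow (I : Type) (r : seq I) (P : pred I) (F : I -> nat) c :
  (forall i, P i -> c <= F i) -> c ^ (\sum_(i <- r | P i) 1) <= \prod_(i <- r | P i) F i.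
Proof.
move=> h.
elim/big_rec2: _ => // i y x Pi IH.
by rewrite addnC expnD expn1 mulnC leq_mul // h.
Qed.

Lemma central_bin_prod n :
  'C(n.*2, n) = \prod_(0 <= p < n.*2.+1 | prime p) p ^ logn p 'C(n.*2, n).
Proof.
have b0 : 0 < 'C(n.*2, n) by rewrite bin_gt0; lia.
rewrite -{1}(partnT b0) (@widen_partn ('C(n.*2, n) + n.*2)) ?leq_addr //.
rewrite (@big_cat_nat _ _ _ n.*2.+1) //=; last by lia.
rewrite [X in _ * X]big_nat_cond [X in _ * X]big1 ?muln1; last first.
  move=> p /andP[/andP[np _] _].
  have [pp|npp] := boolP (prime p); last by rewrite lognE (negbTE npp).
  rewrite logn_central_bin // big_nat_cond big1 // => k /andP[/andP[k0 _] _].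
  rewrite divn_small ?sub0n // (leq_trans np) // -{1}(expn1 p) leq_pexp2l //.
  exact: prime_gt0.
rewrite [RHS]big_mkcond; apply: eq_bigr => p _.
by case: ifP => // /negbT h; rewrite lognE (negbTE h).
Qed.

(** Every prime power in the factorisation is at most [n.*2]. Against [central_bin_ge] this gives
    the lower Chebyshev bound. *)
Lemma central_bin_le_primepi n : 0 < n -> 'C(n.*2, n) <= n.*2 ^ primepi n.*2.+1.
Proof.
move=> n0; rewrite {1}central_bin_prod; apply: leq_prod_pow => p pp.
exact: pexp_logn_central_bin.
Qed.

Lemma logn_central_bin_gt0 p n : prime p -> n < p < n.*2.+1 -> 0 < logn p 'C(n.*2, n).
Proof.
move=> pp /andP[np pn]; rewrite logn_central_bin //.
have n2 : 1 < n.*2.+1 by lia.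
rewrite big_ltn // expn1 (divn_small np) double0.
by rewrite subn0 addn_gt0 divn_gt0 ?(prime_gt0 pp) // -ltnS pn.
Qed.

(** Every prime between [n] and [n.*2] divides the central binomial coefficient. Against
    [central_bin_le] this gives the upper Chebyshev bound. *)
Lemma central_bin_ge_primes n :
  n ^ (\sum_(n.+1 <= p < n.*2.+1 | prime p) 1) <= 'C(n.*2, n).
Proof.
rewrite [leqRHS]central_bin_prod [leqRHS](@big_cat_nat _ _ _ n.+1) //=; last by lia.
rewrite -[X in X <= _]mul1n; apply: leq_mul.
  by rewrite prodn_cond_gt0 // => p pp; rewrite expn_gt0 prime_gt0.
rewrite big_nat_cond [leqRHS]big_nat_cond.
apply: geq_prod_pow => p /andP[/andP[np pn] pp].
apply: leq_trans (ltnW np) _; rewrite -{1}(expn1 p) leq_pexp2l ?(prime_gt0 pp) //.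
by apply: logn_central_bin_gt0 => //; rewrite np.
Qed.

(** * Prime counts at powers of 2 and 16 *)

Lemma primepi_cat m n : m <= n ->
  primepi n = primepi m + \sum_(m <= p < n | prime p) 1.
Proof. by move=> mn; rewrite /primepi (@big_cat_nat _ _ _ m). Qed.

Lemma primepiS n : primepi n.+1 = primepi n + prime n.
Proof.
by rewrite (primepi_cat (leqnSn n)) big_mkcond big_nat1; case: prime.
Qed.

(** [primepi] counts strictly below its argument while the binomial estimates include the endpoint;
    this makes the two agree at powers of 2. *)
Lemma prime_pow2 m : 1 < m -> prime (2 ^ m) = false.
Proof.
move=> m1; apply/negP => /primeP[_ /(_ 2)].
rewrite -{1}(expn1 2) dvdn_exp2l ?(ltnW m1) // => /(_ isT).
by rewrite -{2}(expn1 2) eqn_exp2l // (ltn_eqF m1).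
Qed.

Lemma primepi_pow2_ge m : 1 < m -> 2 ^ m <= m * (primepi (2 ^ m)).+1.
Proof.
case: m => // -[|m _] //.
have n0 : 0 < 2 ^ m.+1 by rewrite expn_gt0.
have := leq_trans (central_bin_ge n0)
  (leq_mul (leqnn _) (central_bin_le_primepi n0)).
rewrite -!muln2 -!expnSr primepiS prime_pow2 // addn0 -expnS -expnM.
by rewrite -[4]/(2 ^ 2) -expnM -expnS leq_exp2l.
Qed.

Lemma primepi_pow2_step m : 1 < m ->
  m * primepi (2 ^ m.+1) <= m * primepi (2 ^ m) + 2 ^ m.+1.
Proof.
case: m => // m m1.
have := leq_trans (central_bin_ge_primes (2 ^ m.+1)) (central_bin_le (2 ^ m.+1)).
rewrite -expnM -[4]/(2 ^ 2) -expnM leq_exp2l // -muln2 -expnSr -expnS.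
have e : \sum_((2 ^ m.+1).+1 <= p < (2 ^ m.+2).+1 | prime p) 1 + primepi (2 ^ m.+1).+1
  = primepi (2 ^ m.+2).+1.
  rewrite addnC -primepi_cat //.
  by rewrite ltnS leq_exp2l.
move: e; rewrite !primepiS !prime_pow2 // !addn0; nia.
Qed.

Lemma primepi_pow2_le m : m * primepi (2 ^ m) <= 2 ^ m.+2.
Proof.
(* Passing from [m] to [m + 1] yields [6 * 2 ^ m / m], which is at most the required
   [8 * 2 ^ m / (m + 1)] only from [m = 3] on; smaller cases are computed. *)
elim: m => // -[|[|[|m]]] IH; try by rewrite /primepi /=; do ?rewrite big_mkcond unlock.
have := @primepi_pow2_step m.+3 isT; move: IH.
move: (primepi (2 ^ m.+3)) (primepi _) => b c.
rewrite !(expnS 2 m.+4.+1) !(expnS 2 m.+4); nia.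
Qed.

Lemma primepi_pow16_le k : k * primepi (16 ^ k) <= 16 ^ k.
Proof.
have := primepi_pow2_le (4 * k).
by rewrite -[(4 * k).+2]addn2 expnD !(expnM 2 4) -[2 ^ 4]/16 -mulnA [leqRHS]mulnC leq_pmul2l.
Qed.

Lemma primepi_pow16_ge k : 0 < k -> 16 ^ k <= 4 * k * (primepi (16 ^ k)).+1.
Proof.
move=> k0; have := @primepi_pow2_ge (4 * k).
by rewrite (expnM 2 4) -[2 ^ 4]/16; apply; lia.
Qed.

(* Blocks of ratio 16, unlike 2, are wide enough for the weak Chebyshev constants
   above to give a lower bound on every block. *)
Lemma prime_level_ge k :
  16 ^ k <= k.+1 * \sum_(16 ^ k <= p < 16 ^ k.+1 | prime p) 1.
Proof.
case: k => [|k]; first by rewrite /= big_mkcond unlock.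
have le : 16 ^ k.+1 <= 16 ^ k.+2 by rewrite leq_exp2l.
have h0 := primepi_cat le.
have h1 := primepi_pow16_le k.+1.
have h2 := @primepi_pow16_ge k.+2 isT.
have h3 : k.+2 <= 16 ^ k.+1 by elim: (k) => // j IH; rewrite expnS; lia.
move: h0 h1 h2 h3.
move: (primepi _) (primepi _) (\sum_(_ <= _ < _ | _) _) => b c d.
rewrite (expnS 16 k.+1); move: (16 ^ k.+1) => a; nia.
Qed.

Lemma prime_level_le k :
  k.+1 * \sum_(16 ^ k <= p < 16 ^ k.+1 | prime p) 1 <= 16 ^ k.+1.
Proof.
have le : 16 ^ k <= 16 ^ k.+1 by rewrite leq_exp2l.
apply: leq_trans (primepi_pow16_le k.+1).
by rewrite leq_mul2l (primepi_cat le) leq_addl orbT.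
Qed.

Local Open Scope ring_scope.

(** * Convolution powers of the harmonic sequence *)

Section Convolution.
Variable R : realType.
Implicit Types (k l m n N M : nat).

Definition lev n := trunc_log 16 n.

Lemma lev_eq k p : (16 ^ k <= p < 16 ^ k.+1)%N -> lev p = k.
Proof. by move=> h; apply: trunc_log_eq. Qed.

Lemma sum_prime_level (g : nat -> R) K :
  \sum_(0 <= p < 16 ^ K | prime p) (p%:R ^- 2 * g (lev p)) =
  \sum_(0 <= k < K) (\sum_(16 ^ k <= p < 16 ^ k.+1 | prime p) p%:R ^- 2) * g k.
Proof.
elim: K => [|K IH].
  by rewrite expn0 big_mkcond big_nat1 big_geq.
rewrite big_nat_recr //= -IH (@big_cat_nat _ _ _ (16 ^ K)) //=; last by rewrite leq_exp2l.
congr (_ + _); rewrite mulr_suml big_nat_cond [RHS]big_nat_cond.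
by apply: eq_bigr => p /andP[h _]; rewrite (lev_eq h).
Qed.

Let mass k : R := \sum_(16 ^ k <= p < 16 ^ k.+1 | prime p) p%:R ^- 2.

(** By [prime_level_le] there are at most [16 ^ k.+1 / k.+1] terms, each at most [16 ^- k]
    squared. *)
Lemma mass_le k : mass k <= 16 * (16 ^- k / k.+1%:R).
Proof.
have q0 : 0 < (16 ^+ k : R) by rewrite exprn_gt0.
apply: (@le_trans _ _ ((\sum_(16 ^ k <= p < 16 ^ k.+1 | prime p) 1)%N%:R * (16 ^- k) ^+ 2)).
  rewrite natr_sum mulr_suml /mass big_nat_cond [leRHS]big_nat_cond.
  apply: ler_sum => p /andP[/andP[h _] _]; rewrite mul1r -exprVn ler_sqr ?nnegrE.
  - rewrite lef_pV2 ?posrE ?q0 // ?ltr0n; first by rewrite -natrX ler_nat.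
    by apply: leq_trans h; rewrite expn_gt0.
  - by rewrite invr_ge0.
  - by rewrite invr_ge0 ltW.
have := prime_level_le k; set c := (\sum_(_ <= _ < _ | _) _)%N => h.
have {}h : k.+1%:R * c%:R <= 16 * (16 ^+ k : R).
  by rewrite -exprS -natrM -natrX ler_nat.
rewrite -ler_pdivlMl // in h; apply: le_trans (ler_wpM2r _ h) _.
  by rewrite sqr_ge0.
rewrite le_eqVlt; apply/orP; left; apply/eqP.
have : (k.+1%:R : R) != 0 by rewrite pnatr_eq0.
move: q0 => /lt0r_neq0; move: (16 ^+ k) k.+1%:R => a b a0 b0; field.
by rewrite a0 b0.
Qed.

(** The factor 256 is the square of 16, lost by bounding each prime by the upper end of its
    level. *)
Lemma mass_ge k : 256^-1 * (16 ^- k / k.+1%:R) <= mass k.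
Proof.
have q0 : 0 < (16 ^+ k : R) by rewrite exprn_gt0.
apply: (@le_trans _ _ ((\sum_(16 ^ k <= p < 16 ^ k.+1 | prime p) 1)%N%:R * (16 ^- k.+1) ^+ 2)).
  have := prime_level_ge k; set c := (\sum_(_ <= _ < _ | _) _)%N => h.
  have {}h : (16 ^+ k : R) <= k.+1%:R * c%:R.
    by rewrite -natrM -natrX ler_nat.
  rewrite -ler_pdivrMl // in h; apply: le_trans (ler_wpM2r _ h).
    rewrite le_eqVlt; apply/orP; left; apply/eqP; rewrite (exprS 16 k).
    have : (k.+1%:R : R) != 0 by rewrite pnatr_eq0.
    move: q0 => /lt0r_neq0; move: (16 ^+ k) k.+1%:R => a b a0 b0; field.
    by rewrite a0 b0.
  by rewrite sqr_ge0.
rewrite natr_sum mulr_suml /mass big_nat_cond [leRHS]big_nat_cond.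
apply: ler_sum => p /andP[/andP[h h'] _]; rewrite mul1r -(exprVn p%:R) ler_sqr ?nnegrE.
- rewrite lef_pV2 ?posrE ?exprn_gt0 // ?ltr0n; first by rewrite -natrX ler_nat ltnW.
  by apply: leq_trans h; rewrite expn_gt0.
- by rewrite invr_ge0 ltW // exprn_gt0.
- by rewrite invr_ge0.
Qed.

(** * Harmonic numbers and their convolutions *)

Definition harm n : R := \sum_(0 <= i < n) i.+1%:R^-1.

Lemma harmS n : harm n.+1 = harm n + n.+1%:R^-1.
Proof. by rewrite /harm big_nat_recr. Qed.

Lemma harm_ge0 n : 0 <= harm n.
Proof. by apply: sumr_ge0 => i _; rewrite invr_ge0. Qed.

Lemma harm_le m n : (m <= n)%N -> harm m <= harm n.
Proof.
move=> mn; rewrite /harm (@big_cat_nat _ _ _ m 0 n) //= lerDl.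
by apply: sumr_ge0 => i _; rewrite invr_ge0.
Qed.

Lemma harm_ge1 n : 1 <= harm n.+1.
Proof.
by apply: le_trans (@harm_le 1 n.+1 isT); rewrite /harm big_nat1 invr1.
Qed.

Lemma harm_double n : harm n.*2 <= 2 * harm n.
Proof.
elim: n => [|n IH]; first by rewrite /harm !big_geq // mulr0.
rewrite doubleS !harmS -addrA mulrDr; apply: lerD => //.
rewrite mulr_natl mulr2n; apply: lerD; rewrite lef_pV2 ?posrE ?ltr0n // ler_nat; lia.
Qed.

Lemma harm_half n : harm n.+1 <= 2 * harm n./2.+1.
Proof.
by apply: le_trans (harm_double _); apply: harm_le; lia.
Qed.

(** Partial fractions: the two denominators always add up to [N.+2], so each product of reciprocals
    is their sum over [N.+2]. *)
Lemma sum_inv_conv N :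
  \sum_(0 <= k < N.+1) (k.+1%:R^-1 * (N - k).+1%:R^-1) = 2 * harm N.+1 / N.+2%:R :> R.
Proof.
have -> : 2 * harm N.+1 = \sum_(0 <= k < N.+1) (k.+1%:R^-1 + (N - k).+1%:R^-1).
  rewrite big_split /= -/(harm _) mulr_natl mulr2n; congr (_ + _).
  by rewrite /harm big_nat_rev /= add0n; apply: eq_bigr => i _; rewrite subSS.
rewrite mulr_suml big_nat_cond [RHS]big_nat_cond; apply: eq_bigr => k /andP[/andP[_ kN] _].
have -> : N.+2%:R = k.+1%:R + (N - k).+1%:R :> R by rewrite -natrD; congr (_%:R); lia.
have ? : (k.+1%:R : R) != 0 by rewrite pnatr_eq0.
have ? : ((N - k).+1%:R : R) != 0 by rewrite pnatr_eq0.
have ? : k.+1%:R + (N - k).+1%:R != 0 :> R by rewrite -natrD pnatr_eq0.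
by rewrite addrC; field; apply/and3P.
Qed.

(* the order of magnitude of the measure of [a_1' ... a_l' >= 16 ^ N] *)
Definition rate l N : R :=
  if l is l'.+1 then 16 ^- N * harm N.+1 ^+ l' / N.+1%:R else (N == 0%N)%:R.

Lemma rate_ge0 l N : 0 <= rate l N.
Proof.
case: l => [|l] /=; first by rewrite ler0n.
by rewrite !mulr_ge0 ?invr_ge0 ?exprn_ge0 ?harm_ge0.
Qed.

Lemma geom_tail N M :
  \sum_(N <= k < M) (16 ^- k / k.+1%:R) <= 2 * (16 ^- N / N.+1%:R) :> R.
Proof.
have [MN|NM] := leqP M N.
  by rewrite big_geq // !mulr_ge0 ?invr_ge0 ?exprn_ge0.
apply: (@le_trans _ _ ((\sum_(N <= k < M) 16 ^- k) / N.+1%:R)).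
  rewrite mulr_suml big_nat_cond [leRHS]big_nat_cond; apply: ler_sum => k /andP[/andP[h _] _].
  by rewrite ler_wpM2l ?invr_ge0 ?exprn_ge0 // lef_pV2 ?posrE ?ltr0n // ler_nat.
rewrite mulrA ler_wpM2r ?invr_ge0 //.
(* The bound is put in telescoping form for the induction:
   [16 ^- j <= 2 * (16 ^- j - 16 ^- j.+1)]. *)
suff : \sum_(N <= k < M) 16 ^- k <= 2 * (16 ^- N - 16 ^- M) :> R.
  by move=> /le_trans; apply; rewrite ler_wpM2l // gerBl invr_ge0 exprn_ge0.
rewrite -(subnKC (ltnW NM)); elim: (M - N)%N => [|j IH].
  by rewrite addn0 big_geq // subrr mulr0.
rewrite addnS big_nat_recr ?leq_addr //=; apply: le_trans (lerD IH (lexx _)) _.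
rewrite exprS invfM.
have : 0 <= (16 ^- (N + j) : R) by rewrite invr_ge0 exprn_ge0.
move: (16 ^- (N + j)) (16 ^- N) => a b; lra.
Qed.

(** Here [k] is the level of the first prime and [N - k] what the others must supply. For [k <= N]
    the powers of 16 combine to [16 ^- N] and [sum_inv_conv] applies; for [k > N] the remainder
    truncates to 0 and leaves a geometric tail of no larger order. *)
Lemma conv_le l N M :
  \sum_(0 <= k < M) (16 ^- k / k.+1%:R * rate l (N - k)) <= 4 * rate l.+1 N.
Proof.
have pos k : 0 <= 16 ^- k / k.+1%:R :> R by rewrite mulr_ge0 ?invr_ge0 ?exprn_ge0.
set c := maxn M N.+1.
apply: (@le_trans _ _ (\sum_(0 <= k < c) (16 ^- k / k.+1%:R * rate l (N - k)))).
  rewrite [leRHS](@big_cat_nat _ _ _ M) ?leq_maxl //= lerDl sumr_ge0 // => k _.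
  by rewrite mulr_ge0 ?rate_ge0.
case: l => [|l].
  rewrite (@big_cat_nat _ _ _ N) //=; last by rewrite /c; lia.
  rewrite big_nat_cond big1 ?add0r; last first.
    move=> k /andP[/andP[_ kN] _].
    by rewrite (_ : (N - k == 0)%N = false) ?mulr0 //; apply/eqP; lia.
  rewrite expr0 mulr1.
  have -> : \sum_(N <= k < c) (16 ^- k / k.+1%:R * (N - k == 0)%N%:R) =
     \sum_(N <= k < c) (16 ^- k / k.+1%:R) :> R.
    rewrite big_nat_cond [RHS]big_nat_cond; apply: eq_bigr => k /andP[/andP[Nk _] _].
    by rewrite (_ : (N - k == 0)%N = true) ?mulr1 //; apply/eqP; lia.
  by apply: le_trans (geom_tail N c) _; rewrite ler_wpM2r // ler_nat.
rewrite (@big_cat_nat _ _ _ N.+1) //=; last by rewrite /c; lia.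
set a := harm N.+1.
have a1 : 1 <= a by exact: harm_ge1.
have h1 : \sum_(0 <= i < N.+1) (16 ^- i / i.+1%:R *
     (16 ^- (N - i) * harm (N - i).+1 ^+ l / (N - i).+1%:R))
   <= 16 ^- N * a ^+ l * (2 * a / N.+2%:R).
  rewrite /a -sum_inv_conv -/a mulr_sumr big_nat_cond [leRHS]big_nat_cond.
  apply: ler_sum => k /andP[/andP[_ kN] _].
  have -> : (16 ^- N : R) = 16 ^- k * 16 ^- (N - k).
    by rewrite -invfM -exprD; congr (16 ^- _); lia.
  rewrite [leLHS](_ : _ = (16 ^- k * 16 ^- (N - k)) * harm (N - k).+1 ^+ l *
    (k.+1%:R^-1 * (N - k).+1%:R^-1)); last by ring.
  apply: ler_wpM2r; first by rewrite mulr_ge0 ?invr_ge0.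
  apply: ler_wpM2l; first by rewrite mulr_ge0 ?invr_ge0 ?exprn_ge0.
  by rewrite lerXn2r ?nnegrE ?harm_ge0 //; apply: harm_le; lia.
have h2 : \sum_(N.+1 <= i < c) (16 ^- i / i.+1%:R *
     (16 ^- (N - i) * harm (N - i).+1 ^+ l / (N - i).+1%:R))
   <= 2 * (16 ^- N / N.+1%:R).
  rewrite (_ : \sum_(_ <= _ < _) _ = \sum_(N.+1 <= i < c) (16 ^- i / i.+1%:R)).
    apply: le_trans (geom_tail _ _) _; rewrite ler_wpM2l //.
    rewrite ler_pM ?invr_ge0 ?exprn_ge0 // lef_pV2 ?posrE ?exprn_gt0 ?ltr0n //.
      by rewrite exprS ler_peMl ?exprn_ge0 ?ler1n.
    by rewrite ler_nat.
  rewrite big_nat_cond [RHS]big_nat_cond; apply: eq_bigr => k /andP[/andP[kN _] _].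
  have -> : (N - k = 0)%N by lia.
  by rewrite expr0 invr1 mul1r /harm big_nat1 invr1 expr1n !mulr1.
apply: le_trans (lerD h1 h2) _.
have -> : 4 * (16 ^- N * a ^+ l.+1 / N.+1%:R) =
  16 ^- N * a ^+ l * (2 * a / N.+1%:R) + 2 * (16 ^- N / N.+1%:R) * a ^+ l.+1.
  by rewrite exprS; ring.
apply: lerD.
  rewrite ler_wpM2l ?mulr_ge0 ?invr_ge0 ?exprn_ge0 //; first by rewrite (le_trans ler01).
  rewrite ler_wpM2l ?mulr_ge0 // ?(le_trans ler01) //.
  by rewrite lef_pV2 ?posrE ?ltr0n // ler_nat.
by rewrite ler_peMr ?mulr_ge0 // exprn_ege1.
Qed.

(** For [l > 0] only [k <= N / 2] is kept, where [harm (N - k).+1] is at least half of [harm N.+1].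
    Each of the [l] harmonic factors, including the one obtained by summing over [k], costs a factor
    2. *)
Lemma conv_ge l N :
  2 ^- l * rate l.+1 N <= \sum_(0 <= k < N.+1) (16 ^- k / k.+1%:R * rate l (N - k)).
Proof.
have pos k : 0 <= 16 ^- k / k.+1%:R :> R by rewrite mulr_ge0 ?invr_ge0 ?exprn_ge0.
case: l => [|l].
  by rewrite big_nat_recr //= subnn expr0 invr1 mul1r !mulr1 lerDr sumr_ge0 //.
rewrite (@big_cat_nat _ _ _ N./2.+1) //=; last by lia.
apply: (@le_trans _ _ (\sum_(0 <= i < N./2.+1) (16 ^- i / i.+1%:R *
     (16 ^- (N - i) * harm (N - i).+1 ^+ l / (N - i).+1%:R)))); last first.
  rewrite lerDl sumr_ge0 // => k _; rewrite mulr_ge0 //.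
  by have := rate_ge0 l.+1 (N - k).
apply: (@le_trans _ _ (16 ^- N * harm N./2.+1 ^+ l / N.+1%:R * harm N./2.+1)).
  rewrite [leRHS](_ : _ = 16 ^- N / N.+1%:R * harm N./2.+1 ^+ l.+1); last first.
    by rewrite exprS; ring.
  rewrite [leLHS](_ : _ = 16 ^- N / N.+1%:R * (2 ^- l.+1 * harm N.+1 ^+ l.+1)); last by ring.
  rewrite ler_wpM2l // -exprVn -exprMn lerXn2r ?nnegrE ?mulr_ge0 ?invr_ge0 ?harm_ge0 //.
  by rewrite ler_pdivrMl // harm_half.
rewrite {2}/harm mulr_sumr big_nat_cond [leRHS]big_nat_cond.
apply: ler_sum => k /andP[/andP[_ kN] _].
have -> : (16 ^- N : R) = 16 ^- k * 16 ^- (N - k).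
  by rewrite -invfM -exprD; congr (16 ^- _); lia.
rewrite [leRHS](_ : _ = (16 ^- k * 16 ^- (N - k)) * (harm (N - k).+1 ^+ l / (N - k).+1%:R) *
    k.+1%:R^-1); last by ring.
rewrite ler_wpM2r ?invr_ge0 // -mulrA ler_wpM2l //.
apply: ler_pM; rewrite ?invr_ge0 ?exprn_ge0 ?harm_ge0 //.
  by rewrite lerXn2r ?nnegrE ?harm_ge0 //; apply: harm_le; lia.
by rewrite lef_pV2 ?posrE ?ltr0n // ler_nat; lia.
Qed.

Lemma prime_rate_le l N M :
  \sum_(0 <= p < M | prime p) (p%:R ^- 2 * rate l (N - lev p)) <= 64 * rate l.+1 N.
Proof.
apply: (@le_trans _ _ (\sum_(0 <= p < 16 ^ M | prime p) (p%:R ^- 2 * rate l (N - lev p)))).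
  rewrite [leRHS](@big_cat_nat _ _ _ M) //=; last exact/ltnW/ltn_expl.
  by rewrite lerDl sumr_ge0 // => p _; rewrite mulr_ge0 ?rate_ge0 // invr_ge0 exprn_ge0.
rewrite (sum_prime_level (fun k => rate l (N - k))).
have -> : 64 * rate l.+1 N = 16 * (4 * rate l.+1 N) by ring.
apply: le_trans (ler_wpM2l _ (conv_le l N M)); rewrite // mulr_sumr.
apply: ler_sum => k _; rewrite mulrA ler_wpM2r ?rate_ge0 //.
exact: mass_le.
Qed.

Lemma prime_rate_ge l N :
  256^-1 * 2 ^- l * rate l.+1 N <=
  \sum_(0 <= p < 16 ^ N.+1 | prime p) (p%:R ^- 2 * rate l (N - lev p)).
Proof.
rewrite (sum_prime_level (fun k => rate l (N - k))) -mulrA.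
apply: le_trans (ler_wpM2l _ (conv_ge l N)) _; first by rewrite invr_ge0.
rewrite mulr_sumr.
apply: ler_sum => k _; rewrite mulrA ler_wpM2r ?rate_ge0 //.
exact: mass_ge.
Qed.

End Convolution.

(** * Comparison with the general term of the series *)

Section Comparison.
Variable R : realType.
Implicit Types (k l m n N M : nat) (t : R).

Lemma ln_le_subr1 t : 0 < t -> ln t <= t - 1.
Proof.
by move=> t0; rewrite -{1}(subrKC 1 t) le_ln1Dx // ltrBDr; lra.
Qed.

(* [3 > (6/5)^6] and [ln (5/6) <= -1/6] *)
Lemma ln3_gt1 : 1 < ln 3 :> R.
Proof.
apply: (@le_lt_trans _ _ (ln ((6 / 5) ^+ 6))); last first.
  by rewrite ltr_ln ?posrE //; lra.
have /ln_le_subr1 : 0 < (6 / 5)^-1 :> R by lra.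
rewrite lnXn; last by lra.
rewrite lnV ?posrE; last by lra.
by rewrite invf_div -mulr_natr; lra.
Qed.

(** The lower bound 3 on [phi] enters through this constant: [ln (ln t)] stays above it, so additive
    constants can be absorbed into multiples of [ln (ln t)]. *)
Lemma lnln3_gt0 : 0 < ln (ln 3) :> R.
Proof. by rewrite ln_gt0 // ln3_gt1. Qed.

Lemma ln_le_harm n : ln n.+1%:R <= harm R n.
Proof.
elim: n => [|n IH]; first by rewrite ln1 harm_ge0.
rewrite harmS; have n0 : 0 < n.+1%:R :> R by rewrite ltr0n.
have -> : n.+2%:R = n.+1%:R * (1 + n.+1%:R^-1) :> R.
  by rewrite mulrDr mulr1 divff ?lt0r_neq0 // natr1.
have i0 : 0 < n.+1%:R^-1 :> R by rewrite invr_gt0.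
rewrite lnM ?posrE ?addr_gt0 //.
by apply: lerD => //; rewrite le_ln1Dx // (lt_trans _ i0) // ltrN10.
Qed.

Lemma harm_le_ln n : harm R n.+1 <= 1 + ln n.+1%:R.
Proof.
elim: n => [|n IH]; first by rewrite ln1 addr0 /harm big_nat1 invr1.
rewrite harmS; have n0 : 0 < n.+1%:R :> R by rewrite ltr0n.
have m0 : 0 < n.+2%:R :> R by rewrite ltr0n.
have : ln (n.+1%:R / n.+2%:R) <= n.+1%:R / n.+2%:R - 1 :> R.
  by apply: ln_le_subr1; rewrite divr_gt0.
rewrite ln_div ?posrE //.
have -> : n.+1%:R / n.+2%:R - 1 = - n.+2%:R^-1 :> R.
  apply: (mulIf (lt0r_neq0 m0)); rewrite mulrBl divfK ?lt0r_neq0 // mul1r mulNr.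
  by rewrite mulVf ?lt0r_neq0 // -[n.+2%:R]natr1; ring.
move: IH; move: (ln _) (ln _) (harm _ _) (_^-1) => a b c d; lra.
Qed.

Lemma lev_truncn t : 1 <= t ->
  16 ^+ lev (Num.truncn t) <= t < 16 ^+ (lev (Num.truncn t)).+1.
Proof.
move=> t1; have t0 : 0 <= t by rewrite (le_trans ler01).
have /andP[h1 h2] := truncn_itv t0.
have T0 : (0 < Num.truncn t)%N by rewrite truncn_gt0.
apply/andP; split.
  by apply: le_trans h1; rewrite -natrX ler_nat trunc_logP.
apply: (lt_le_trans h2).
by rewrite -natrX ler_nat trunc_log_ltn.
Qed.

Section Bounds.
Variables (t : R) (M : nat).
Hypotheses (t3 : 3 <= t) (tM : 16 ^+ M <= t < 16 ^+ M.+1).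

Let t0 : 0 < t. Proof. by apply: lt_le_trans t3. Qed.

Lemma ln_ge1 : 1 <= ln t.
Proof.
by apply: (le_trans (ltW ln3_gt1)); rewrite ler_ln ?posrE.
Qed.

Lemma lnln_ge : ln (ln 3) <= ln (ln t).
Proof.
have h := ln_ge1; have h3 := ln3_gt1.
by rewrite !ler_ln ?posrE //; [exact: lt_trans h3 | exact: lt_le_trans h].
Qed.

(** The 15 is the crude bound [ln 16 <= 16 - 1]. *)
Lemma ln_le_level : ln t <= 15 * M.+1%:R.
Proof.
have /andP[_ /ltW h] := tM.
have : ln t <= ln (16 ^+ M.+1) by rewrite ler_ln ?posrE // exprn_gt0.
rewrite lnXn // => /le_trans; apply; rewrite -[ln _ *+ _]mulr_natr ler_wpM2r //.
by have := @ln_le_subr1 16 ltac:(by []); lra.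
Qed.

Lemma level_le_ln : M.+1%:R <= 2 * ln t.
Proof.
have /andP[h _] := tM.
have : ln (16 ^+ M) <= ln t by rewrite ler_ln ?posrE // exprn_gt0.
rewrite lnXn // -[ln _ *+ _]mulr_natl -[M.+1%:R]natr1.
have : 1 <= ln 16 :> R.
  by apply: (le_trans (ltW ln3_gt1)); rewrite ler_ln ?posrE // ler_nat.
have : 0 <= M%:R :> R by [].
have := ln_ge1; move: (M%:R) (ln t) (ln 16) => a b c; nra.
Qed.

Lemma lnln_le_harm : ln (ln t) <= 15 * harm R M.+1.
Proof.
have l0 : 0 < ln t by rewrite (lt_le_trans ltr01) // ln_ge1.
have : ln (ln t) <= ln (15 * M.+1%:R).
  by rewrite ler_ln ?posrE ?ln_le_level // mulr_gt0 // ltr0n.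
rewrite lnM ?posrE ?ltr0n // => /le_trans; apply.
have := @ln_le_subr1 15 ltac:(by []).
have := ln_le_harm M; have := harm_le R (leqnSn M); have := harm_ge1 R M; lra.
Qed.

Lemma harm_le_lnln : harm R M.+1 <= (2 / ln (ln 3) + 1) * ln (ln t).
Proof.
have l0 : 0 < ln t by rewrite (lt_le_trans ltr01) // ln_ge1.
apply: (le_trans (harm_le_ln M)).
have : ln M.+1%:R <= ln (2 * ln t).
  by rewrite ler_ln ?posrE ?level_le_ln // ?mulr_gt0 // ltr0n.
rewrite lnM ?posrE // => h.
have h2 := @ln_le_subr1 2 ltac:(by []).
apply: (@le_trans _ _ (2 + ln (ln t))); first lra.
rewrite mulrDl mul1r lerD2r -mulrA ler_peMr //.
by rewrite mulrC ler_pdivlMr ?lnln3_gt0 // mul1r lnln_ge.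
Qed.

(** The level is rounded up because [16 ^+ M.+1] exceeds [t], so a block reaching it has product at
    least [t]. The 64 is 16 from the rounding times 4 from [M.+2 <= 4 * ln t]. *)
Lemma rate_ge_series l :
  64^-1 * 15 ^- l * (ln (ln t) ^+ l / (t * ln t)) <= rate R l.+1 M.+1.
Proof.
have l1 := ln_ge1; have l0 : 0 < ln t by rewrite (lt_le_trans ltr01).
have ll0 : 0 <= ln (ln t) by rewrite (le_trans _ lnln_ge) // ltW // lnln3_gt0.
have /andP[h _] := tM.
rewrite /rate [leLHS](_ : _ = (16^-1 * t^-1) * (15^-1 * ln (ln t)) ^+ l * (4 * ln t)^-1).
  apply: ler_pM.
  - by rewrite !mulr_ge0 ?invr_ge0 ?exprn_ge0 ?mulr_ge0 ?invr_ge0 // ltW.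
  - by rewrite invr_ge0 mulr_ge0 // ltW.
  - apply: ler_pM.
    + by rewrite mulr_ge0 ?invr_ge0 // ltW.
    + by rewrite exprn_ge0 // mulr_ge0 ?invr_ge0.
    + rewrite -invfM lef_pV2 ?posrE ?exprn_gt0 ?mulr_gt0 // exprS ler_wpM2l //.
    + rewrite lerXn2r ?nnegrE ?harm_ge0 ?mulr_ge0 ?invr_ge0 //.
      rewrite ler_pdivrMl //; apply: (le_trans lnln_le_harm).
      by rewrite ler_wpM2l // harm_le.
  - rewrite lef_pV2 ?posrE ?mulr_gt0 ?ltr0n //.
    have := level_le_ln; have : 1 <= M.+1%:R :> R by rewrite ler1n.
    rewrite -[M.+2%:R]natr1; lra.
rewrite exprMn exprVn; field.
by rewrite !gt_eqF ?exprn_gt0.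
Qed.

(** The level is lowered by one for each of the [l.+1] primes, since each may exceed the power of 16
    at its level by nearly a factor 16. The shift costs [16 ^+ l.+2] and [l.+2]. *)
Lemma rate_le_series l :
  rate R l.+1 (M - l.+1) <=
  16 ^+ l.+2 * (2 / ln (ln 3) + 1) ^+ l * (15 * l.+2%:R) *
    (ln (ln t) ^+ l / (t * ln t)).
Proof.
have l1 := ln_ge1; have l0 : 0 < ln t by rewrite (lt_le_trans ltr01).
have ll0 : 0 <= ln (ln t) by rewrite (le_trans _ lnln_ge) // ltW // lnln3_gt0.
have /andP[_ h] := tM; have l3 := lnln3_gt0.
have c0 : 0 <= 2 / ln (ln 3) + 1 :> R by rewrite addr_ge0 // divr_ge0 // ltW.
rewrite /rate [leRHS](_ : _ = (16 ^+ l.+2 * t^-1) *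
   ((2 / ln (ln 3) + 1) * ln (ln t)) ^+ l * (15 * l.+2%:R / ln t)); last first.
  rewrite exprMn; field.
  by rewrite !gt_eqF.
apply: ler_pM.
- by rewrite mulr_ge0 ?invr_ge0 ?exprn_ge0 ?harm_ge0.
- by rewrite invr_ge0.
- apply: ler_pM.
  + by rewrite invr_ge0 exprn_ge0.
  + by rewrite exprn_ge0 ?harm_ge0.
  + rewrite -ler_pdivrMl ?exprn_gt0 // -invfM -exprD lef_pV2 ?posrE ?exprn_gt0 //.
    by apply: (le_trans (ltW h)); rewrite ler_weXn2l ?ler1n //; lia.
  + rewrite lerXn2r ?nnegrE ?harm_ge0 ?mulr_ge0 //.
    by apply: le_trans harm_le_lnln; apply: harm_le; lia.
- rewrite ler_pdivlMr // mulrC ler_pdivrMr ?ltr0n //.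
  apply: (le_trans ln_le_level); rewrite -mulrA ler_wpM2l // -natrM ler_nat.
  nia.
Qed.

End Bounds.
End Comparison.

Local Open Scope classical_set_scope.

(** * Cylinders of continued fractions *)

Section Cylinders.
Variable R : realType.
Implicit Types (k l m n b : nat) (s : seq nat) (x y : R).

(** These are the irrationals of the unit interval, encoded by a Gauss orbit that never reaches 0,
    the form in which digits are handled. *)
Definition infcf : set R :=
  [set x | 0 < x < 1 /\ forall k, iter k (@gauss R) x != 0].

Lemma gauss_itv x : 0 <= x -> 0 <= gauss x < 1.
Proof.
move=> x0; have /truncn_itv/andP[h1 h2] : 0 <= x^-1 by rewrite invr_ge0.
by rewrite /gauss subr_ge0 h1 /= ltrBDr addrC natr1.
Qed.

Lemma infcf_gauss x : infcf x -> infcf (gauss x).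
Proof.
move=> [/andP[x0 x1] h]; have /andP[g0 g1] := gauss_itv (ltW x0).
split=> [|k]; last by rewrite -iterSr h.
by rewrite g1 lt_neqAle g0 eq_sym (h 1).
Qed.

Lemma infcf_iter k x : infcf x -> infcf (iter k (@gauss R) x).
Proof. by move=> h; elim: k => //= k /infcf_gauss. Qed.

Lemma infcf_pq_gt0 n x : infcf x -> (0 < pq n.+1 x)%N.
Proof.
move=> /(infcf_iter n)[/andP[h0 h1] _].
by rewrite /pq /= truncn_gt0 invf_ge1 // ltW.
Qed.

(** Running the expansion backwards from 0 produces a rational; hence only countably many points are
    discarded by working in [infcf]. *)
Lemma gauss_iter_eq0_rat k x : iter k (@gauss R) x = 0 -> range (@ratr R) x.
Proof.
elim: k x => [x /= ->|k IH x]; first by exists 0 => //; rewrite raddf0.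
rewrite iterSr => /IH[r _ rE].
exists (r + (Num.truncn x^-1)%:R)^-1 => //.
by rewrite fmorphV rmorphD /= rmorph_nat rE /gauss subrK invrK.
Qed.

Lemma countable_not_infcf : countable (`[0, 1[%classic `\` infcf).
Proof.
apply: (@sub_countable _ _ _ (range (@ratr R))); last exact: (sub_countable (card_image_le _ _)) (countableP _).
apply: subset_card_le => x [/=]; rewrite in_itv /= => /andP[x0 x1] nx.
have [->|xn0] := eqVneq x 0; first by exists 0 => //; rewrite raddf0.
apply: contrapT => nr; apply: nx; split.
  by rewrite x1 andbT lt_neqAle eq_sym xn0.
by move=> k; apply/eqP => /gauss_iter_eq0_rat.
Qed.

Lemma measurable_countable (A : set R) : countable A -> measurable A.
Proof. by apply: countable_measurable => ?; exact: measurable_set1. Qed.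

Lemma infcfE : infcf = `[0, 1[%classic `\` (`[0, 1[%classic `\` infcf).
Proof.
rewrite setDD; apply/seteqP; split=> x [] // /andP[x0 x1] h.
by split; [rewrite /= in_itv /= ltW | split; rewrite ?x0].
Qed.

Lemma measurable_infcf : measurable infcf.
Proof.
rewrite infcfE; apply: measurableD; first exact: measurable_itv.
by apply: measurable_countable; exact: countable_not_infcf.
Qed.

Lemma lebesgue_infcfI (A : set R) : measurable A -> A `<=` `[0, 1[%classic ->
  lebesgue_measure (infcf `&` A) = lebesgue_measure A.
Proof.
move=> mA A01; have mX := measurable_infcf.
have c : countable (A `\` infcf).
  apply: sub_countable countable_not_infcf; apply: subset_card_le.
  exact: setSD.
rewrite -[in RHS](setUIDK A infcf) setIC measureU //.
- by rewrite [X in (_ + X)%E](countable_lebesgue_measure0 c) adde0.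
- exact: measurableI.
- exact: measurable_countable.
- by rewrite setIC setDE setIACA setICl setI0.
Qed.

(** * Digit words, inverse branches and the measure of cylinders *)

Definition digits m x : seq nat := mkseq (fun i => pq i.+1 x) m.

Arguments digits : simpl never.

Lemma size_digits m x : size (digits m x) = m.
Proof. exact: size_mkseq. Qed.

Lemma digitsS m x : digits m.+1 x = pq 1 x :: digits m (gauss x).
Proof.
rewrite /digits /mkseq /= (iotaDl 1 0) -map_comp; congr (_ :: _).
by apply: eq_map => i; rewrite /pq /= -iterS iterSr.
Qed.

Lemma digits_rcons m x : digits m.+1 x = rcons (digits m x) (pq m.+1 x).
Proof. by rewrite /digits mkseqS. Qed.

Definition cyl s : set R := [set x | infcf x /\ digits (size s) x = s].

(* the numerator and denominator of [1/(b_1 + 1/(b_2 + ... + 1/(b_m + y)))] *)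
Fixpoint cf s y : R * R :=
  if s is b :: s' then ((cf s' y).2, b%:R * (cf s' y).2 + (cf s' y).1) else (y, 1).

Notation num s y := (cf s y).1.
Notation den s y := (cf s y).2.

(** Bounded distortion: moving the tail [y] within the unit interval at most doubles the
    denominator. The last bound carries the induction, since the numerator alone may more than
    double (for the empty word it is [y] against 0). *)
Lemma cf_bounds s y : 0%N \notin s -> 0 <= y <= 1 ->
  [/\ 0 <= num s 0 <= num s y, 1 <= den s 0 <= den s y, den s y <= 2 * den s 0 &
      num s y + den s y <= 2 * (num s 0 + den s 0)].
Proof.
move=> + /andP[y0 y1]; elim: s => [_|b s IH] /=.
  by rewrite lexx y0 lexx; split => //; lra.
rewrite inE negb_or eq_sym -lt0n => /andP[b0 /IH[/andP[h1 h2] /andP[h3 h4] h5 h6]].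
have : 1 <= b%:R :> R by rewrite ler1n.
move: (num s 0) (num s y) (den s 0) (den s y) (b%:R) h1 h2 h3 h4 h5 h6 => n0 n d0 d r.
move=> h1 h2 h3 h4 h5 h6 r1; split.
- by apply/andP; split; lra.
- by apply/andP; split; nra.
- nra.
- nra.
Qed.

(** Prepending a digit acts by a matrix of determinant -1, which preserves the cross product up to
    sign. *)
Lemma cf_det s x y : `|num s y * den s x - num s x * den s y| = `|y - x|.
Proof.
elim: s => [|b s IH] /=; first by rewrite !mulr1.
by rewrite -IH -normrN; congr `|_|; ring.
Qed.

(** The inverse branch, on the cylinder of [s], of the Gauss map iterated [size s] times. *)
Definition mob s y : R := num s y / den s y.

Lemma mob_cons b s y : den s y != 0 -> mob (b :: s) y = (b%:R + mob s y)^-1.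
Proof.
by move=> h; rewrite /mob /= -[b%:R in RHS](mulfK h) -mulrDl invf_div.
Qed.

Definition cylI s (a c : R) : set R :=
  [set x | [/\ infcf x, digits (size s) x = s & a < iter (size s) (@gauss R) x < c]].

(** Each digit acts by the decreasing map sending [y] to [(b + y)^-1], so orientation alternates
    with the length of [s]; hence the two cases for the endpoints. *)
Lemma cylI_itv s (a c : R) : 0%N \notin s -> 0 <= a -> a < c -> c <= 1 ->
  exists u v : R, [/\ 0 <= u, u < v, v <= 1,
    (u = mob s a /\ v = mob s c) \/ (u = mob s c /\ v = mob s a) &
    cylI s a c = infcf `&` `]u, v[%classic].
Proof.
move=> + a0 ac c1; elim: s => [_|b s IH] /=.
  exists a, c; split => //.
    by left; rewrite /mob /= !divr1.
  apply/seteqP; split=> x /=; rewrite ?in_itv /=; first by case.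
  by case.
rewrite inE negb_or eq_sym -lt0n => /andP[b0 s0].
have [u [v [u0 uv v1 uvE sE]]] := IH s0.
have b1 : 1 <= b%:R :> R by rewrite ler1n.
have bu : 0 < b%:R + u by lra.
have bv : 0 < b%:R + v by lra.
exists (b%:R + v)^-1, (b%:R + u)^-1; split.
- by rewrite invr_ge0 ltW.
- by rewrite ltf_pV2 ?posrE // ltrD2l.
- by rewrite invf_le1 //; lra.
- have da : den s a != 0.
    have [_ /andP[h1 h2] _ _] := @cf_bounds s a s0 ltac:(apply/andP; split; lra).
    by rewrite gt_eqF //; lra.
  have dc : den s c != 0.
    have [_ /andP[h1 h2] _ _] := @cf_bounds s c s0 ltac:(apply/andP; split; lra).
    by rewrite gt_eqF //; lra.
  by rewrite !mob_cons //; case: uvE => -[-> ->]; [right|left].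
apply/seteqP; split=> x /=.
  rewrite /cylI /= digitsS -iterS iterSr => -[Xx [xb xs] xi].
  have : cylI s a c (gauss x) by split=> //; exact: infcf_gauss.
  rewrite sE => -[_]; rewrite /= in_itv /= /gauss.
  rewrite -[pq 1 x]/(Num.truncn x^-1) in xb; rewrite xb => /andP[h1 h2].
  split => //; have [/andP[x0 _] _] := Xx.
  rewrite in_itv /= -[x in (_ < x < _)]invrK !ltf_pV2 ?posrE ?invr_gt0 //.
  by apply/andP; split; lra.
move=> [Xx]; have [/andP[x0 _] _] := Xx.
rewrite in_itv /= -[x in (_ < x < _)]invrK !ltf_pV2 ?posrE ?invr_gt0 // => /andP[h1 h2].
have tb : Num.truncn x^-1 = b.
  by apply: truncn_def; rewrite -natr1; apply/andP; split; lra.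
have : cylI s a c (gauss x).
  rewrite sE; split; first exact: infcf_gauss.
  by rewrite /= in_itv /= /gauss tb; apply/andP; split; lra.
move=> [_ xs xi]; split => //; last by rewrite [size _]/= iterSr.
by rewrite digitsS xs -tb.
Qed.

Lemma lebesgue_cylI s (a c : R) : 0%N \notin s -> 0 <= a -> a < c -> c <= 1 ->
  lebesgue_measure (cylI s a c) = ((c - a) / (den s a * den s c))%:E.
Proof.
move=> s0 a0 ac c1; have [u [v [u0 uv v1 uvE ->]]] := cylI_itv s0 a0 ac c1.
rewrite lebesgue_infcfI; last first.
- move=> x /=; rewrite !in_itv /= => /andP[h1 h2]; apply/andP; split; lra.
- exact: measurable_itv.
rewrite lebesgue_measure_itv /= lte_fin uv -EFinB; congr (_%:E).
have [_ /andP[h1 h2] _ _] := @cf_bounds s a s0 ltac:(apply/andP; split; lra).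
have [_ /andP[_ h3] _ _] := @cf_bounds s c s0 ltac:(apply/andP; split; lra).
have da : 0 < den s a by lra.
have dc : 0 < den s c by lra.
have -> : v - u = `|mob s c - mob s a|.
  case: uvE => -[<- <-]; first by rewrite gtr0_norm // subr_gt0.
  by rewrite distrC gtr0_norm // subr_gt0.
have -> : mob s c - mob s a = (num s c * den s a - num s a * den s c) / (den s a * den s c).
  by rewrite /mob; field; rewrite !gt_eqF.
by rewrite normrM cf_det normfV !gtr0_norm ?mulr_gt0 // subr_gt0.
Qed.

Lemma measurable_cylI s (a c : R) : 0%N \notin s -> 0 <= a -> a < c -> c <= 1 ->
  measurable (cylI s a c).
Proof.
move=> s0 a0 ac c1; have [u [v [_ _ _ _ ->]]] := cylI_itv s0 a0 ac c1.
by apply: measurableI; [exact: measurable_infcf|exact: measurable_itv].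
Qed.

Lemma cylE s : cyl s = cylI s 0 1.
Proof.
apply/seteqP; split=> x; last by case.
by move=> [Xx xs]; split=> //; have [] := infcf_iter (size s) Xx.
Qed.

Lemma cyl_in0 s : 0%N \in s -> cyl s = set0.
Proof.
move=> s0; apply/seteqP; split=> // x [Xx xs].
move: s0; rewrite -xs => /mapP[i _ /esym/eqP].
by rewrite eqn0Ngt infcf_pq_gt0.
Qed.

Lemma measurable_cyl s : measurable (cyl s).
Proof.
have [s0|s0] := boolP (0%N \in s); first by rewrite cyl_in0.
by rewrite cylE; apply: measurable_cylI.
Qed.

Lemma cyl_rcons s b : (0 < b)%N -> cyl (rcons s b) = cylI s b.+1%:R^-1 b%:R^-1.
Proof.
move=> b0; apply/seteqP; split=> x.
  move=> [Xx]; rewrite size_rcons digits_rcons => /rcons_inj[xs xb]; split=> //.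
  have [/andP[y0 y1] h] := infcf_iter (size s) Xx.
  (* The endpoint [b^-1] is excluded because its Gauss image is 0. *)
  have := h 1; rewrite /= {1}/gauss.
  move: xb; rewrite /pq /=.
  move: (iter _ _ x) y0 y1 {h} => y y0 y1 yb; rewrite yb => yn.
  have /truncn_itv/andP[h1 h2] : 0 <= y^-1 by rewrite invr_ge0 ltW.
  rewrite yb in h1 h2.
  rewrite -[y]invrK !ltf_pV2 ?posrE ?invr_gt0 ?ltr0n // h2 /=.
  by rewrite lt_neqAle h1 andbT eq_sym -subr_eq0.
move=> [Xx xs xi]; split=> //.
rewrite size_rcons digits_rcons xs /pq /=; congr rcons.
have [/andP[y0 y1] h] := infcf_iter (size s) Xx.
move: xi y0; move: (iter _ _ x) => y yi y0; move: yi.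
rewrite -[y in (_ < y < _)]invrK !ltf_pV2 ?posrE ?invr_gt0 ?ltr0n // => /andP[h1 h2].
by apply: truncn_def; rewrite h1 ltW.
Qed.

Lemma lebesgue_cyl s : 0%N \notin s ->
  lebesgue_measure (cyl s) = ((den s 0 * den s 1)^-1)%:E.
Proof. by move=> s0; rewrite cylE lebesgue_cylI // subr0 mul1r. Qed.

Lemma lebesgue_cyl_rcons s b : 0%N \notin s -> (0 < b)%N ->
  lebesgue_measure (cyl (rcons s b)) =
  ((b%:R * b.+1%:R)^-1 / (den s b.+1%:R^-1 * den s b%:R^-1))%:E.
Proof.
move=> s0 b0; have b1 : 1 <= b%:R :> R by rewrite ler1n.
rewrite cyl_rcons // lebesgue_cylI //.
- congr (_ / _)%:E; rewrite -natr1; field.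
  by rewrite !gt_eqF //; lra.
- by rewrite ltf_pV2 ?posrE ?ltr0n // ltr_nat.
- by rewrite invf_le1 //; lra.
Qed.

Lemma cyl_rcons_in0 s b : 0%N \in s -> cyl (rcons s b) = set0.
Proof. by move=> s0; apply: cyl_in0; rewrite mem_rcons inE s0 orbT. Qed.

Lemma cyl_den_bounds s b : 0%N \notin s -> (0 < b)%N ->
  [/\ 1 <= den s 0, den s 0 <= den s 1 <= 2 * den s 0,
     den s 0 <= den s b%:R^-1 <= 2 * den s 0 &
     den s 0 <= den s b.+1%:R^-1 <= 2 * den s 0].
Proof.
move=> s0 b0.
have h c : (0 < c)%N -> 0 <= (c%:R^-1 : R) <= 1.
  by move=> c0; rewrite invr_ge0 ler0n /= invf_le1 ?ltr0n // ler1n.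
have [_ /andP[-> ->] -> _] := @cf_bounds s 1 s0 ltac:(by rewrite ler01 lexx).
have [_ /andP[_ ->] -> _] := cf_bounds s0 (h _ b0).
by have [_ /andP[_ ->] -> _] := cf_bounds s0 (h b.+1 isT).
Qed.

(** The factor 2 is the distortion [den s 1 <= 2 * den s 0]; the other denominators are only bounded
    below by [den s 0]. *)
Lemma lebesgue_cyl_rcons_le s b : (0 < b)%N ->
  (lebesgue_measure (cyl (rcons s b)) <= (2 * b%:R ^- 2)%:E * lebesgue_measure (cyl s))%E.
Proof.
move=> b0; have [s0|s0] := boolP (0%N \in s).
  by rewrite cyl_rcons_in0 // cyl_in0 // measure0 mule0.
have [h0 /andP[h1 h2] /andP[h3 h4] /andP[h5 h6]] := cyl_den_bounds s0 b0.
rewrite lebesgue_cyl_rcons // lebesgue_cyl // -EFinM lee_fin.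
have b1 : 1 <= b%:R :> R by rewrite ler1n.
move: (den s _) (den s _) (den s 0) (den s 1) h0 h1 h2 h3 h4 h5 h6 => p q d e h0 h1 h2 h3 h4 h5 h6.
have -> : 2 * b%:R ^- 2 * (d * e)^-1 = b%:R ^- 2 / (d * e / 2).
  by field; rewrite !gt_eqF //; lra.
apply: ler_pM.
- by rewrite invr_ge0 mulr_ge0.
- by rewrite invr_ge0 mulr_ge0 //; lra.
- by rewrite lef_pV2 ?posrE ?exprn_gt0 ?mulr_gt0 ?ltr0n // expr2 ler_wpM2l // ler_nat.
- by rewrite lef_pV2 ?posrE ?divr_gt0 ?mulr_gt0 //; nra.
Qed.

(** The 8 is 4 from the distortion of two denominators times 2 from [b.+1 <= 2 * b]. *)
Lemma lebesgue_cyl_rcons_ge s b : (0 < b)%N ->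
  ((8^-1 * b%:R ^- 2)%:E * lebesgue_measure (cyl s) <= lebesgue_measure (cyl (rcons s b)))%E.
Proof.
move=> b0; have [s0|s0] := boolP (0%N \in s).
  by rewrite cyl_rcons_in0 // cyl_in0 // measure0 mule0.
have [h0 /andP[h1 h2] /andP[h3 h4] /andP[h5 h6]] := cyl_den_bounds s0 b0.
rewrite lebesgue_cyl_rcons // lebesgue_cyl // -EFinM lee_fin.
have b1 : 1 <= b%:R :> R by rewrite ler1n.
move: (den s _) (den s _) (den s 0) (den s 1) h0 h1 h2 h3 h4 h5 h6 => p q d e h0 h1 h2 h3 h4 h5 h6.
have -> : 8^-1 * b%:R ^- 2 * (d * e)^-1 = (2 * b%:R ^+ 2)^-1 / (4 * (d * e)).
  by field; rewrite !gt_eqF //; lra.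
apply: ler_pM.
- by rewrite invr_ge0 mulr_ge0 // exprn_ge0.
- by rewrite invr_ge0 !mulr_ge0 //; lra.
- rewrite lef_pV2 ?posrE ?mulr_gt0 ?exprn_gt0 ?ltr0n //.
  by rewrite -[b.+1%:R]natr1; nra.
- by rewrite lef_pV2 ?posrE ?mulr_gt0 //; nra.
Qed.

End Cylinders.

(** * Blocks of prime partial quotients *)

Section Events.
Variable R : realType.
Implicit Types (k l m n b : nat) (s : seq nat) (x y : R) (A D : set R).
Local Notation X := (@infcf R).
Local Notation leb := (@lebesgue_measure R).

Definition determined m D := forall x y, X x -> X y ->
  digits m x = digits m y -> D x -> D y.

Lemma digits_pq m x y k : (k < m)%N -> digits m x = digits m y -> pq k.+1 x = pq k.+1 y.
Proof.
by move=> km h; have := congr1 (fun s => nth 0%N s k) h; rewrite !nth_mkseq.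
Qed.

(** Words are indexed by their codes in [nat] so that countable additivity applies to a sequence of
    sets; all other codes give the empty set. *)
Definition cyl_enum (S : set (seq nat)) (n : nat) : set R :=
  if pickle_inv n is Some s then (if `[< S s >] then @cyl R s else set0) else set0.

Lemma measurable_cyl_enum S n : measurable (cyl_enum S n).
Proof.
rewrite /cyl_enum; case: pickle_inv => [s|] //; case: ifP => // _.
exact: measurable_cyl.
Qed.

Lemma trivIset_cyl_enum S : (forall s s', S s -> S s' -> size s = size s') ->
  trivIset setT (cyl_enum S).
Proof.
move=> sS; apply/trivIsetP => i j _ _ ij; apply/seteqP; split=> // x [].
rewrite /cyl_enum; case ei: pickle_inv => [s|] //; case: ifP => // /asboolP Ss [_ xs].
case ej: pickle_inv => [s'|] //; case: ifP => // /asboolP Ss' [_ xs'].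
have e : s = s' by rewrite -xs -xs' (sS _ _ Ss Ss').
have := @pickle_invK (seq nat) i; have := @pickle_invK (seq nat) j; rewrite ei ej /= -e => hj hi.
by rewrite -hi -hj eqxx in ij.
Qed.

Lemma determined_bigcup m D : determined m D ->
  X `&` D = \bigcup_n cyl_enum (digits m @` (X `&` D)) n.
Proof.
move=> dD; apply/seteqP; split=> x.
  move=> XDx; exists (pickle (digits m x)) => //.
  rewrite /cyl_enum pickleK_inv ifT; last by apply/asboolP; exists x.
  by split; [case: XDx | rewrite size_digits].
move=> [n _]; rewrite /cyl_enum; case: pickle_inv => [s|] //.
case: ifP => // /asboolP[y [Xy Dy] <-] [Xx]; rewrite size_digits => xy.
by split=> //; apply: dD Dy.
Qed.

Lemma measurable_determined m D : determined m D -> measurable (X `&` D).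
Proof.
move=> /determined_bigcup ->; apply: bigcup_measurable => n _.
exact: measurable_cyl_enum.
Qed.

(** A determined set is a countable disjoint union of cylinders of one length, so a comparison on
    cylinders adds up. Two arbitrary measures are allowed so that Lebesgue measure restricted to an
    event and a multiple of it can stand on either side. *)
Lemma le_determined (mu nu : {measure set (measurableTypeR R) -> \bar R}) m D :
  determined m D ->
  (forall s, size s = m -> (mu (@cyl R s) <= nu (@cyl R s))%E) ->
  (mu (X `&` D) <= nu (X `&` D))%E.
Proof.
move=> dD le; rewrite (determined_bigcup dD).
set S := digits m @` _.
have tS : trivIset setT (cyl_enum S).
  by apply: trivIset_cyl_enum => s s' [x _ <-] [y _ <-]; rewrite !size_digits.
have mS := measurable_cyl_enum S.
have mU : measurable (\bigcup_n cyl_enum S n) by exact: bigcup_measurable.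
rewrite !measure_semi_bigcup //.
apply: lee_nneseries => [//|n _]; rewrite /cyl_enum.
case: pickle_inv => [s|]; last by rewrite !measure0.
case: ifP => [/asboolP[x _ <-]|_]; last by rewrite !measure0.
by rewrite le // size_digits.
Qed.

Lemma determined_le m D A (c : R) : determined m D -> measurable A -> 0 <= c ->
  (forall s, size s = m -> (leb (@cyl R s `&` A) <= c%:E * leb (@cyl R s))%E) ->
  (leb (X `&` D `&` A) <= c%:E * leb (X `&` D))%E.
Proof.
move=> dD mA c0 h.
exact: (@le_determined (mrestr leb mA) (mscale (NngNum c0) leb) m D dD h).
Qed.

Lemma determined_ge m D A (c : R) : determined m D -> measurable A -> 0 <= c ->
  (forall s, size s = m -> (c%:E * leb (@cyl R s) <= leb (@cyl R s `&` A))%E) ->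
  (c%:E * leb (X `&` D) <= leb (X `&` D `&` A))%E.
Proof.
move=> dD mA c0 h.
exact: (@le_determined (mscale (NngNum c0) leb) (mrestr leb mA) m D dD h).
Qed.

(* The partial quotients number m+1, ..., m+l are primes whose levels sum to at
   least N; truncated subtraction turns the final test into [N == 0]. *)
Fixpoint blk l N m x : bool :=
  if l is l'.+1 then prime (pq m.+1 x) && blk l' (N - lev (pq m.+1 x))%N m.+1 x
  else (N == 0)%N.

Lemma determined_blk l N m : determined (m + l) [set x | blk l N m x].
Proof.
move=> x y _ _ h /=.
suff -> : blk l N m x = blk l N m y by [].
elim: l N m h => [|l IH] N m //= h.
have h1 : pq m.+1 x = pq m.+1 y by apply: digits_pq h; lia.
by rewrite h1 IH // addSn -addnS.
Qed.

Lemma pow_le_prod_of_blk l N m x : blk l N m x ->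
  (16 ^ N <= \prod_(m.+1 <= k < m.+1 + l) pq' k x)%N.
Proof.
elim: l N m => [|l IH] N m /=.
  by move=> /eqP ->; rewrite addn0 big_geq.
move=> /andP[pp /IH]; rewrite addSn -addnS => h.
rewrite big_ltn ?{1}/pq' ?pp; last by lia.
have : (16 ^ lev (pq m.+1 x) <= pq m.+1 x)%N by rewrite trunc_logP // prime_gt0.
move=> /leq_mul/(_ h); apply: leq_trans.
by rewrite -expnD leq_exp2l //; lia.
Qed.

(** Each prime is below [16 ^ (lev + 1)], so reading levels off a product loses at most one per
    factor. *)
Lemma blk_of_pow_le_prod l N m x :
  (16 ^ N <= \prod_(m.+1 <= k < m.+1 + l) pq' k x)%N -> blk l (N - l)%N m x.
Proof.
elim: l N m => [|l IH] N m /=.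
  by rewrite addn0 big_geq // -[leqRHS]/(16 ^ 0)%N leq_exp2l // subn0 leqn0.
rewrite big_ltn; last by lia.
rewrite addnS -addSn.
rewrite {1}/pq'; case: ifP => [pp|_]; last first.
  by rewrite mul0n leqn0 expn_eq0.
set a := pq m.+1 x => h /=.
have -> : (N - l.+1 - lev a = N - lev a - 1 - l)%N by lia.
apply: IH; move: h; set P := (\prod_(_ <= _ < _) _)%N => h.
have h2 : (a < 16 ^ (lev a).+1)%N by rewrite trunc_log_ltn.
have P0 : (0 < P)%N.
  by rewrite lt0n; apply: contraTneq h => ->; rewrite muln0 leqn0 expn_eq0.
have [Na|aN] := leqP N (lev a).+1.
  by rewrite (_ : _ - _ - _ = 0)%N //; lia.
have : (16 ^ (lev a).+1 * 16 ^ (N - lev a - 1) <= 16 ^ (lev a).+1 * P)%N.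
  rewrite -expnD (_ : _ + _ = N)%N; last by lia.
  by apply: (leq_trans h); rewrite leq_mul // ltnW.
by rewrite leq_pmul2l // expn_gt0.
Qed.

Lemma cyl_blkS s l N :
  @cyl R s `&` [set x | blk l.+1 N (size s) x] =
  \bigcup_p (if prime p then
     @cyl R (rcons s p) `&` [set x | blk l (N - lev p)%N (size (rcons s p)) x] else set0).
Proof.
apply/seteqP; split=> x.
  move=> [[Xx xs] /= /andP[pp bx]]; exists (pq (size s).+1 x) => //.
  by rewrite pp; split; rewrite ?size_rcons //; split=> //; rewrite size_rcons digits_rcons xs.
move=> [p _]; case: ifP => // pp [[Xx]]; rewrite /= size_rcons digits_rcons => /rcons_inj[xs xp].
by rewrite xp pp.
Qed.

Lemma cyl_blk0 s N m :
  @cyl R s `&` [set x | blk 0 N m x] = if N == 0%N then @cyl R s else set0.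
Proof.
by rewrite /=; case: eqP => _; apply/seteqP; split=> x // -[].
Qed.

Lemma trivIset_cyl_rcons s (B : nat -> set R) :
  trivIset setT (fun p => if prime p then @cyl R (rcons s p) `&` B p else set0).
Proof.
apply/trivIsetP => i j _ _ ij; apply/seteqP; split=> // x [].
case: ifP => // _ [[_]]; rewrite size_rcons digits_rcons => /rcons_inj[_ xi] _.
case: ifP => // _ [[_]]; rewrite size_rcons digits_rcons => /rcons_inj[_ xj] _.
by move: ij; rewrite -xi xj eqxx.
Qed.

Lemma measurable_cyl_blk s l N m : measurable (@cyl R s `&` [set x | blk l N m x]).
Proof.
have -> : @cyl R s `&` [set x | blk l N m x] = @cyl R s `&` (X `&` [set x | blk l N m x]).
  by rewrite setIA; congr (_ `&` _); apply/esym/setIidl => x [].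
apply: measurableI; first exact: measurable_cyl.
exact: measurable_determined (@determined_blk l N m).
Qed.

Lemma lebesgue_cyl_fin s : leb (@cyl R s) \is a fin_num.
Proof.
have [s0|s0] := boolP (0%N \in s); first by rewrite cyl_in0 // measure0.
by rewrite lebesgue_cyl.
Qed.

Lemma lebesgue_blkS s l N :
  leb (@cyl R s `&` [set x | blk l.+1 N (size s) x]) =
  (\sum_(0 <= p <oo) if prime p then
     leb (@cyl R (rcons s p) `&` [set x | blk l (N - lev p)%N (size (rcons s p)) x])
   else 0)%E.
Proof.
rewrite cyl_blkS; set F := fun p : nat => if prime p then _ else _.
have mF p : measurable (F p).
  by rewrite /F; case: ifP => // _; exact: measurable_cyl_blk.
have tF : trivIset setT F by exact: trivIset_cyl_rcons.
have mU : measurable (\bigcup_p F p) by exact: bigcup_measurable.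
rewrite measure_semi_bigcup // /F.
by apply: eq_eseriesr => p _; case: ifP; rewrite ?measure0.
Qed.

(** Induction by conditioning on the next prime; the past enters only through the measure of its
    cylinder, so [c] is uniform in [s]. Each step costs 128: 2 from distortion times 64 from
    [prime_rate_le]. *)
Lemma lebesgue_blk_le l : exists2 c : R, 0 < c & forall s N,
  (leb (@cyl R s `&` [set x | blk l N (size s) x]) <= (c * rate R l N)%:E * leb (@cyl R s))%E.
Proof.
elim: l => [|l [c c0 IH]].
  exists 1 => // s N; rewrite mul1r cyl_blk0 /=.
  by case: eqP => _; rewrite ?mul1e // measure0 mul0e.
exists (128 * c) => [|s N]; first by rewrite mulr_gt0.
rewrite lebesgue_blkS; have /fineK <- := lebesgue_cyl_fin s.
set L := fine _; have L0 : 0 <= L by rewrite fine_ge0.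
rewrite -EFinM; apply: lime_le; first by apply: is_cvg_nneseries => p _ _; case: ifP.
apply: nearW => n.
apply: (@le_trans _ _ (\sum_(0 <= p < n)
   (if prime p then 2 * c * L * (p%:R ^- 2 * rate R l (N - lev p)) else 0)%:E)%E).
  apply: lee_sum => p _; case: ifP => // pp.
  apply: (le_trans (IH _ _)).
  have r0 : 0 <= c * rate R l (N - lev p) by rewrite mulr_ge0 ?rate_ge0 // ltW.
  apply: (le_trans (lee_wpmul2l _ (lebesgue_cyl_rcons_le _ _ (prime_gt0 pp)))).
    by rewrite lee_fin.
  have /fineK <- := lebesgue_cyl_fin s; rewrite -/L -!EFinM lee_fin.
  by rewrite le_eqVlt; apply/orP; left; apply/eqP; ring.
rewrite sumEFin lee_fin -big_mkcond -mulr_sumr /=.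
have := prime_rate_le R l N n; set S := \sum_(_ <= _ < _ | _) _ => hS.
have -> : 128 * c * rate R l.+1 N * L = 2 * c * L * (64 * rate R l.+1 N) by ring.
by rewrite ler_wpM2l // !mulr_ge0 // ltW.
Qed.

Lemma lebesgue_blk_ge l : exists2 c : R, 0 < c & forall s N,
  ((c * rate R l N)%:E * leb (@cyl R s) <= leb (@cyl R s `&` [set x | blk l N (size s) x]))%E.
Proof.
elim: l => [|l [c c0 IH]].
  exists 1 => // s N; rewrite mul1r cyl_blk0 /=.
  by case: eqP => _; rewrite ?mul1e // measure0 mul0e.
exists (8^-1 * c * (256^-1 * 2 ^- l)) => [|s N].
  by rewrite !mulr_gt0 // !invr_gt0 // exprn_gt0.
rewrite lebesgue_blkS; have /fineK <- := lebesgue_cyl_fin s.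
set L := fine _; have L0 : 0 <= L by rewrite fine_ge0.
(* A partial sum suffices: primes below [16 ^ N.+1] already fill the levels 0 to [N]. *)
rewrite -EFinM; apply: le_trans (nneseries_lim_ge (16 ^ N.+1) _); last first.
  by move=> p _ _; case: ifP.
apply: (@le_trans _ _ (\sum_(0 <= p < 16 ^ N.+1)
   (if prime p then 8^-1 * c * L * (p%:R ^- 2 * rate R l (N - lev p)) else 0)%:E)%E); last first.
  apply: lee_sum => p _; case: ifP => // pp.
  apply: le_trans (IH _ _).
  have r0 : 0 <= c * rate R l (N - lev p) by rewrite mulr_ge0 ?rate_ge0 // ltW.
  apply: le_trans (lee_wpmul2l _ (lebesgue_cyl_rcons_ge _ _ (prime_gt0 pp))).
    have /fineK <- := lebesgue_cyl_fin s; rewrite -/L -!EFinM lee_fin.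
    by rewrite le_eqVlt; apply/orP; left; apply/eqP; ring.
  by rewrite lee_fin.
rewrite sumEFin lee_fin -big_mkcond -mulr_sumr.
apply: le_trans (ler_wpM2l _ (prime_rate_ge R l N)).
  by rewrite le_eqVlt; apply/orP; left; apply/eqP; ring.
by rewrite !mulr_ge0 ?invr_ge0 // ltW.
Qed.

End Events.

(** * Convergence and divergence *)

(** Sorting indices by residue modulo [l] lets the bounds for the interleaved families of disjoint
    blocks be added. *)
Lemma sum_nat_mul (R : nmodType) (f : nat -> R) K l :
  \sum_(0 <= n < K * l) f n = \sum_(0 <= r < l) \sum_(0 <= j < K) f (r + j * l)%N.
Proof.
rewrite exchange_big /=; elim: K => [|K IH]; first by rewrite mul0n !big_geq.
rewrite big_nat_recr //= -IH mulSnr (@big_cat_nat _ _ _ (K * l)) ?leq_addr //=.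
by congr (_ + _); rewrite -{1}(add0n (K * l)%N) big_addn addKn.
Qed.

Section Dichotomy.
Variables (R : realType) (l : nat) (phi : nat -> R).
Hypothesis phi3 : forall n, 3 <= phi n.
Implicit Types (k m n b : nat) (s : seq nat) (x y : R).
Local Notation X := (@infcf R).
Local Notation leb := (@lebesgue_measure R).

(* Indexed from 0: this is the event of the theorem at [n + 1]. *)
Definition large n : set R :=
  [set x | phi n.+1 <= (\prod_(n.+1 <= k < n.+1 + l.+1) pq' k x)%:R].

Let u n : R := ln (ln (phi n)) ^+ l / (phi n * ln (phi n)).

Lemma u_ge0 n : 0 <= u n.
Proof.
have h := phi3 n; have h1 := ln_ge1 h; have h2 := lnln_ge h; have h3 := lnln3_gt0 R.
rewrite /u divr_ge0 ?exprn_ge0 ?mulr_ge0 //; lra.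
Qed.

Lemma determined_large n : determined (n + l.+1) (large n).
Proof.
move=> x y _ _ h; rewrite /large /=.
suff -> : (\prod_(n.+1 <= k < n.+1 + l.+1) pq' k x =
  \prod_(n.+1 <= k < n.+1 + l.+1) pq' k y)%N by [].
apply: eq_big_nat => -[|k] // /andP[_ kn]; rewrite /pq'.
by rewrite (@digits_pq _ _ _ y _ _ h) //; lia.
Qed.

Lemma measurable_large n : measurable (X `&` large n).
Proof. exact: measurable_determined (@determined_large n). Qed.

Lemma cylIX s (B : set R) : @cyl R s `&` B = @cyl R s `&` (X `&` B).
Proof. by rewrite setIA; congr (_ `&` _); apply/esym/setIidl => x []. Qed.

Let M n := lev (Num.truncn (phi n.+1)).

Let phiM n : 16 ^+ M n <= phi n.+1 < 16 ^+ (M n).+1.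
Proof. by apply: lev_truncn; apply: le_trans (phi3 _); rewrite ler1n. Qed.

Lemma lebesgue_large_ge : exists2 c : R, 0 < c & forall n s, size s = n ->
  ((c * u n.+1)%:E * leb (@cyl R s) <= leb (@cyl R s `&` (X `&` large n)))%E.
Proof.
have [c c0 h] := @lebesgue_blk_ge R l.+1.
exists (c * (64^-1 * 15 ^- l)) => [|n s sn].
  by rewrite !mulr_gt0 // invr_gt0 // exprn_gt0.
have := h s (M n).+1; rewrite sn => hs.
apply: le_trans (le_trans hs _).
  rewrite lee_wpmul2r // lee_fin -mulrA ler_wpM2l ?(ltW c0) //.
  exact: (rate_ge_series (phi3 n.+1) (phiM n)).
apply: le_measure; rewrite ?inE.
- exact: measurable_cyl_blk.
- by apply: measurableI; [exact: measurable_cyl | exact: measurable_large].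
rewrite -cylIX; apply: setIS => x hx.
have {hx} hb := @pow_le_prod_of_blk R l.+1 _ _ _ hx.
have /andP[_ /ltW hp] := phiM n; apply: (le_trans hp).
by rewrite -natrX ler_nat.
Qed.

Lemma lebesgue_large_le : exists2 c : R, 0 < c & forall n s, size s = n ->
  (leb (@cyl R s `&` (X `&` large n)) <= (c * u n.+1)%:E * leb (@cyl R s))%E.
Proof.
have [c c0 h] := @lebesgue_blk_le R l.+1.
have l3 := lnln3_gt0 R.
exists (c * (16 ^+ l.+2 * (2 / ln (ln 3) + 1) ^+ l * (15 * l.+2%:R))) => [|n s sn].
  have p1 : 0 < 16 ^+ l.+2 :> R by rewrite exprn_gt0.
  have p2 : 0 < (2 / ln (ln 3) + 1) ^+ l :> R.
    by rewrite exprn_gt0 // addr_gt0 // divr_gt0.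
  have p3 : 0 < 15 * l.+2%:R :> R by rewrite mulr_gt0 ?ltr0n.
  by apply/mulr_gt0/mulr_gt0 => //; exact: mulr_gt0.
have := h s (M n - l.+1)%N; rewrite sn => hs.
apply: (le_trans (le_trans _ hs)); last first.
  rewrite lee_wpmul2r // lee_fin -mulrA ler_wpM2l ?(ltW c0) //.
  exact: (rate_le_series (phi3 n.+1) (phiM n)).
apply: le_measure; rewrite ?inE.
- by apply: measurableI; [exact: measurable_cyl | exact: measurable_large].
- exact: measurable_cyl_blk.
rewrite -cylIX; apply: setIS => x hx; apply: (@blk_of_pow_le_prod R l.+1).
have /andP[hp _] := phiM n.
by have := le_trans hp hx; rewrite -natrX ler_nat.
Qed.

Lemma lebesgue_infcf : leb X = 1%E.
Proof.
have <- : @cyl R [::] = X by apply/seteqP; split=> x //; case.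
by rewrite lebesgue_cyl //= mulr1 invr1.
Qed.

Lemma lebesgue_Eprime :
  leb (Eprime l.+1 phi) = leb (lim_sup_set (fun n => X `&` large n)).
Proof.
set F := fun n => _.
have -> : Eprime l.+1 phi = lim_sup_set F `|` (Eprime l.+1 phi `\` X).
  apply/seteqP; split=> x.
    have [Xx|nX] := pselect (X x); last by right.
    move=> [_ h]; left=> N _.
    (* Asking for an index beyond [N.+1] leaves one beyond [N] after the shift to indexing from
       0. *)
    have [[|n] [Nn [// _ hn]]] := h N.+1.
    by exists n.
  move=> [h|[]//]; have [n _ [Xx _]] := h 0%N I.
  split; first by have [/andP[x0 x1] _] := Xx; rewrite ltW.
  move=> N; have [k Nk [_ hk]] := h N I.
  by exists k.+1; split=> //; rewrite ltnW.
have c : countable (Eprime l.+1 phi `\` X).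
  apply: sub_countable (countable_not_infcf R); apply: subset_card_le.
  by apply: setSD => x [h _]; rewrite /= in_itv.
rewrite measureU0 //; last exact: countable_lebesgue_measure0.
- apply: bigcap_measurable => // n _; apply: bigcup_measurable => k _.
  exact: measurable_large.
- exact: measurable_countable.
Qed.

Lemma Eprime_null :
  (\sum_(1 <= n <oo) (u n)%:E < +oo)%E -> leb (Eprime l.+1 phi) = 0%E.
Proof.
move=> fin; rewrite lebesgue_Eprime; have [c c0 h] := lebesgue_large_le.
have uu n : (0 <= (u n)%:E)%E by rewrite lee_fin u_ge0.
apply: lim_sup_set_cvg0 => [k|]; first exact: measurable_large.
apply: (@le_lt_trans _ _ (c%:E * \sum_(1 <= n <oo) (u n)%:E)%E); last first.
  by rewrite lte_mul_pinfty // lee_fin ltW.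
apply: lime_le; first by apply: is_cvg_nneseries.
apply: nearW => K.
apply: (@le_trans _ _ (c%:E * \sum_(1 <= n < K.+1) (u n)%:E)%E); last first.
  rewrite lee_wpmul2l ?lee_fin ?(ltW c0) //.
  by apply: nneseries_lim_ge.
rewrite big_add1 /= ge0_sume_distrr //; apply: lee_sum => n _.
have := @determined_le R n setT _ (c * u n.+1) _ (measurable_large n) _ (h n).
rewrite !setIT setIA setIid lebesgue_infcf mule1 EFinM; apply=> //.
by rewrite mulr_ge0 ?u_ge0 // ltW.
Qed.

(** * Divergence: points avoiding all late events *)

Let avoid N : set R := X `&` [set x | forall n, (N <= n)%N -> ~ large n x].

(** The spacing [l.+1] is the block length, so the blocks are disjoint and avoiding the first [K]
    events is decided by digits preceding the next block. *)
Let avoidK N K : set R := [set x | forall j, (j < K)%N -> ~ large (N + j * l.+1) x].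

Lemma determined_avoidK N K : determined (N + K * l.+1) (avoidK N K).
Proof.
move=> x y Xx Xy h Dx j jK Lj; apply: (Dx j jK).
apply: (determined_large Xy Xx _ Lj).
set m := (N + j * l.+1 + l.+1)%N.
have mK : (m <= N + K * l.+1)%N by rewrite /m; nia.
apply: (@eq_from_nth _ 0%N); rewrite ?size_digits // => i im.
rewrite !nth_mkseq //; apply/esym; apply: digits_pq h; exact: leq_trans mK.
Qed.

Lemma avoidK_bound (c : R) : 0 < c ->
  (forall n s, size s = n ->
    ((c * u n.+1)%:E * leb (@cyl R s) <= leb (@cyl R s `&` (X `&` large n)))%E) ->
  forall N K, (leb (X `&` avoidK N K) *
    (1 + \sum_(0 <= j < K) c * u (N + j * l.+1).+1)%:E <= 1)%E.
Proof.
move=> c0 h N; have lefin K : leb (X `&` avoidK N K) \is a fin_num.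
  rewrite ge0_fin_numE //; apply: (@le_lt_trans _ _ 1%E); last exact: ltry.
  rewrite -lebesgue_infcf; apply: le_measure; rewrite ?inE.
  - exact: measurable_determined (@determined_avoidK N K).
  - exact: measurable_infcf.
  - exact: subIsetl.
elim=> [|K IH].
  rewrite big_geq // addr0 mule1 -lebesgue_infcf; apply: le_measure; rewrite ?inE.
  - exact: measurable_determined (@determined_avoidK N 0).
  - exact: measurable_infcf.
  - exact: subIsetl.
set n := (N + K * l.+1)%N; set v := c * u n.+1.
have v0 : 0 <= v by rewrite mulr_ge0 ?u_ge0 // ltW.
have mW := measurable_determined (@determined_avoidK N K).
have mL := measurable_large n.
have hW := determined_ge (@determined_avoidK N K) mL v0 (h n).
have e : X `&` avoidK N K.+1 = (X `&` avoidK N K) `\` (X `&` large n).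
  apply/seteqP; split=> x.
    move=> [Xx a]; split; last by move=> [_]; apply: a.
    by split=> // j jK; apply: a; rewrite ltnW.
  move=> [[Xx a] nl]; split=> // j; rewrite ltnS leq_eqVlt => /orP[/eqP ->|/a//].
  by move=> L; apply: nl.
have := measureDI leb mW mL; rewrite -e => /esym.
move: IH hW; rewrite big_nat_recr //=.
have := lefin K; have := lefin K.+1.
have l1 : leb (X `&` avoidK N K `&` (X `&` large n)) \is a fin_num.
  rewrite ge0_fin_numE //.
  apply: (@le_lt_trans _ _ (leb (X `&` avoidK N K))); last by rewrite -ge0_fin_numE.
  by apply: le_measure; rewrite ?inE //; exact: measurableI.
move: l1; move=> /fineK <- /fineK <- /fineK <-.
have := fine_ge0 (measure_ge0 leb (X `&` avoidK N K)).
rewrite -/n -/v -!EFinM -EFinD !lee_fin.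
move: (fine _) (fine _) (fine _) => w' z w w0 IH hv [] E.
have : 0 <= \sum_(0 <= i < K) c * u (N + i * l.+1).+1.
  by apply: sumr_ge0 => i _; rewrite mulr_ge0 ?u_ge0 // ltW.
move: (\sum_(_ <= _ < _) _) IH => S IH S0.
have hw : w' <= (1 - v) * w by lra.
(* The induction closes because [(1 - v) * (1 + S + v) = 1 + S - v * S - v ^+ 2], which is at most
   [1 + S]. *)
apply: (@le_trans _ _ ((1 - v) * w * (1 + (S + v)))).
  by apply: ler_wpM2r => //; lra.
apply: le_trans IH.
have := mulr_ge0 w0 (mulr_ge0 v0 S0); have := mulr_ge0 w0 (mulr_ge0 v0 v0); lra.
Qed.

Lemma measurable_avoid N : measurable (avoid N).
Proof.
have -> : avoid N = X `\` \bigcup_(n in [set n | (N <= n)%N]) (X `&` large n).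
  apply/seteqP; split=> x [Xx h]; split=> //.
    by move=> [n /h + [_ L]]; apply.
  by move=> n Nn L; apply: h; exists n.
apply: measurableD; first exact: measurable_infcf.
by apply: bigcup_measurable => n _; exact: measurable_large.
Qed.

Lemma avoid_null N : (\sum_(1 <= n <oo) (u n)%:E = +oo)%E -> leb (avoid N) = 0%E.
Proof.
move=> inf; have [c c0 hc] := lebesgue_large_ge.
have mN := measurable_avoid N.
have /fineK gE : leb (avoid N) \is a fin_num.
  rewrite ge0_fin_numE //; apply: (@le_lt_trans _ _ 1%E); last exact: ltry.
  rewrite -lebesgue_infcf; apply: le_measure; rewrite ?inE //.
  - exact: measurable_infcf.
  - exact: subIsetl.
rewrite -gE; congr (_%:E); set g := fine _ in gE *.
have g0 : 0 <= g by rewrite fine_ge0.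
have sum0 m1 m2 (f : nat -> nat) : 0 <= \sum_(m1 <= i < m2) u (f i).
  by apply: sumr_ge0 => i _; exact: u_ge0.
have hr r K : g * (1 + c * \sum_(0 <= j < K) u (N + (r + j * l.+1)).+1) <= 1.
  rewrite -lee_fin EFinM gE; apply: le_trans (avoidK_bound c0 hc (N + r) K).
  rewrite -mulr_sumr; under [in leRHS]eq_bigr do rewrite -addnA.
  rewrite lee_wpmul2r //.
    by rewrite lee_fin addr_ge0 // mulr_ge0 // ltW.
  apply: le_measure; rewrite ?inE //.
    exact: measurable_determined (@determined_avoidK (N + r) K).
  by move=> x [Xx h]; split=> // j _; apply: h; lia.
have hK K : g * (l.+1%:R + c * \sum_(0 <= n < K * l.+1) u (N + n).+1) <= l.+1%:R.
  rewrite (sum_nat_mul (fun n => u (N + n).+1)).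
  have -> : l.+1%:R = \sum_(0 <= r < l.+1) 1 :> R by rewrite sumr_const_nat subn0.
  rewrite mulr_sumr -big_split /= mulr_sumr.
  by apply: ler_sum => r _; exact: hr.
apply/eqP; rewrite eq_le g0 andbT leNgt; apply/negP => gp.
(* If [g > 0], the bound [hK] caps all partial sums past [N] by [l.+1%:R / (g * c)], contradicting
   divergence. *)
have : (\sum_(1 <= n <oo) (u n)%:E <=
    (\sum_(0 <= n < N) u n.+1 + l.+1%:R / (g * c))%:E)%E.
  apply: lime_le; first by apply: is_cvg_nneseries => n _ _; rewrite lee_fin u_ge0.
  apply: nearW => k; rewrite sumEFin lee_fin big_add1.
  apply: (@le_trans _ _ (\sum_(0 <= n < N + k * l.+1) u n.+1)).
    rewrite [leRHS](@big_cat_nat _ _ _ k.-1) //=; last by nia.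
    by rewrite lerDl sum0.
  rewrite (@big_cat_nat _ _ _ N) ?leq_addr //= lerD2l.
  rewrite -{1}(add0n N) big_addn addKn.
  under eq_bigr do rewrite addnC.
  rewrite ler_pdivlMr ?mulr_gt0 //.
  have := hK k; have : 0 <= l.+1%:R :> R by [].
  move: (\sum_(_ <= _ < _) _) (l.+1%:R) => S L L0; nra.
by rewrite inf leye_eq.
Qed.

Lemma Eprime_full :
  (\sum_(1 <= n <oo) (u n)%:E = +oo)%E -> leb (Eprime l.+1 phi) = 1%E.
Proof.
move=> inf; rewrite lebesgue_Eprime; set E := lim_sup_set _.
have mE : measurable E.
  apply: bigcap_measurable => // n _; apply: bigcup_measurable => k _.
  exact: measurable_large.
have mX := @measurable_infcf R.
have : leb X = (leb (X `\` E) + leb (X `&` E))%E by exact: (measureDI leb mX mE).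
rewrite lebesgue_infcf.
have -> : X `&` E = E.
  by apply: setIidr => x /(_ 0%N I)[n _ []].
suff -> : leb (X `\` E) = 0%E by rewrite add0e.
apply/eqP; rewrite -measure_le0.
(* A point of [X] outside the limsup avoids every event from some [N] on, so [X] minus [E] is
   covered by countably many null sets. *)
have -> : 0%E = (\sum_(0 <= N <oo) leb (avoid N))%E.
  by rewrite eseries0 // => N _ _; exact: avoid_null.
apply: measure_sigma_subadditive => [N||x [Xx nE]].
- exact: measurable_avoid.
- exact: measurableD.
apply: contrapT => nU; apply: nE => N _.
apply: contrapT => nL; apply: nU; exists N => //; split=> // n Nn L.
by apply: nL; exists n.
Qed.

End Dichotomy.

Theorem theorem1p8 (R : realType) (l : nat) (phi : nat -> R) :
  (0 < l)%N ->
  (forall n, 3 <= phi n) ->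
  let u := fun n : nat =>
    (ln (ln (phi n))) ^+ l.-1 / (phi n * ln (phi n)) in
  (((\sum_(1 <= n <oo) (u n)%:E < +oo)%E ->
      (lebesgue_measure (Eprime l phi) = 0%E)) /\
   ((\sum_(1 <= n <oo) (u n)%:E = +oo)%E ->
      (lebesgue_measure (Eprime l phi) = 1%E))).
Proof.
case: l => // l _ phi3 /=; split; [exact: Eprime_null | exact: Eprime_full].
Qed.
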